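(* Let $\mathbb{F}$ be a perfect field of characteristic $2$ that is not quadratically closed, with $|\mathbb{F}|>2$. Let $V$ be a vector space over $\mathbb{F}$ with finite dimension $n\geq 3$. Let $S$ be a weakly triangularizable linear subspace of $\mathrm{End}(V)$. Then either $S$ is a hurdle or there exists an $S$-adapted vector in $V$.
   Context: A field $\mathbb{F}$ is called quadratically closed when every polynomial of degree $2$ with coefficients in $\mathbb{F}$ has a root in $\mathbb{F}$. Let $V$ be a finite-dimensional $\mathbb{F}$-vector space with dual space $V^\star$. A subset of $\mathrm{End}(V)$ is weakly triangularizable when each of its elements is triangularizable over $\mathbb{F}$ (i.e. represented by an upper-triangular matrix in some basis of $V$, which may depend on the element). For $\varphi\in V^\star$ and $y\in V$, $\varphi\otimes y$ denotes the endomorphism $x\mapsto \varphi(x)\,y$ of $V$; its trace is $\varphi(y)$. Let $S$ be a linear subspace of $\mathrm{End}(V)$. A nonzero vector $x\in V$ is $S$-adapted when $S$ contains no operator with range $\mathbb{F}x$ and trace zero, i.e. the only $\varphi\in V^\star$ with $\varphi(x)=0$ and $\varphi\otimes x\in S$ is $\varphi=0$. When $\dim V\geq 2$, $S$ is called a hurdle when there exists a $2$-dimensional linear subspace $P$ of $V^\star$ such that $S$ contains all the operators $\varphi\otimes x$ with $x\in V$, $\varphi\in P$ and $\varphi(x)=0$. *)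

(* Defs.v *)
From HB Require Import structures.
From mathcomp Require Import all_boot all_order all_algebra all_field.

Set Implicit Arguments.
Unset Strict Implicit.
Unset Printing Implicit Defensive.

Import GRing.Theory passmx.
Local Open Scope ring_scope.

Definition perfect_field (F : fieldType) : Prop :=
  forall p : {poly F}, irreducible_poly p -> separable_poly p.

(* [size p = 3] says that p has degree exactly 2. *)
Definition quadratically_closed (F : fieldType) : Prop :=
  forall p : {poly F}, size p = 3 -> exists x : F, root p x.

Section Operators.
Variables (F : fieldType) (V : vectType F).

Notation dual := 'Hom(V, F^o).

(* [mxof] acts on row vectors: its i-th row holds the coordinates of f b_i.
   Thus [is_trig_mx] (zero entries for i < j) says that f b_i lies in the span
   of b_0, ..., b_i, i.e. that the usual column-convention matrix of f in b,
   the transpose of [mxof b b f], is upper-triangular. *)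
Definition triangularizable (f : 'End(V)) : Prop :=
  exists b : (\dim {:V}).-tuple V,
    basis_of {:V} b /\ is_trig_mx (mxof b b f).

Definition weakly_triangularizable (S : {vspace 'End(V)}) : Prop :=
  forall f : 'End(V), f \in S -> triangularizable f.

Definition tensor_fun (phi : dual) (y x : V) : V := (phi x : F) *: y.

Fact tensor_fun_linear phi y : linear (tensor_fun phi y).
Proof. by move=> a u v; rewrite /tensor_fun linearP scalerDl scalerA. Qed.

HB.instance Definition _ phi y :=
  GRing.isSemilinear.Build F V V *:%R (tensor_fun phi y)
    (GRing.semilinear_linear (tensor_fun_linear phi y)).

Definition tensor (phi : dual) (y : V) : 'End(V) := linfun (tensor_fun phi y).

(* [linfun] is meaningful only on linear functions. *)
Lemma tensorE phi y x : tensor phi y x = (phi x : F) *: y.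
Proof. by rewrite lfunE. Qed.

(* The operators with range F x are the [tensor phi x] with phi nonzero, and
   the trace of [tensor phi x] is [phi x]. *)
Definition adapted (S : {vspace 'End(V)}) (x : V) : Prop :=
  x != 0 /\
  forall phi : dual, phi x = 0 -> tensor phi x \in S -> phi = 0.

(* The existence of a plane P in the dual space forces 2 <= \dim {:V}. *)
Definition hurdle (S : {vspace 'End(V)}) : Prop :=
  exists P : {vspace dual}, \dim P = 2 /\
    forall (phi : dual) (x : V), phi \in P -> phi x = 0 -> tensor phi x \in S.

End Operators.

(* Main.v *)
(* Suppose that no vector is adapted, so that every x has a nonzero form phi_x
   with phi_x(x) = 0 and phi_x (x) x in S.

   If t^2 + t + a has no root, three such operators combine to one with
   characteristic polynomial (t - 1)(t^2 + t + a) on the span of their vectors,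
   unless the cyclic products phi_x(y) phi_y(z) phi_z(x) and
   phi_x(z) phi_z(y) phi_y(x) agree; so they agree as soon as
   phi_x(y) phi_y(x) is nonzero. This is the symmetry of the matrix
   (phi_x(y)) up to a rescaling of the forms.

   Call x and y linked when phi_x(y) phi_y(x) is nonzero. As |F| >= 4, counting
   on a grid F_0 e_1 + ... + F_0 e_n with |F_0| = 4 gives a vector x_1 whose
   linked vectors are not covered by two hyperplanes. Rescaling the forms on
   these vectors turns them into one alternating form b on V, with b(x, -)
   proportional to phi_x whenever it is nonzero, so b(x, -) (x) x lies in S
   for all x.

   If b had rank at least 4, polarizing would give in S operators that
   stabilize a totally isotropic plane and induce any given endomorphism of it,
   some of which are not triangularizable. So b has rank 2, and the plane of
   the forms b(x, -) makes S a hurdle. *)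
Require Import Defs.
From mathcomp Require Import all_boot all_order all_algebra all_field.
From mathcomp Require Import ring zify.
From Stdlib Require Import Classical.
Import GRing.Theory passmx.

Set Implicit Arguments.
Unset Strict Implicit.
Unset Printing Implicit Defensive.

Local Open Scope ring_scope.

(** * Triangularizable operators and quadratic polynomials *)

(** Let [j] be the last index with [r 0 j] nonzero. As [M] is lower triangular, it preserves the row
    vectors supported on indices up to [j] and multiplies their coordinate [j] by [M j j], which is
    therefore the root. *)
Lemma trig_mx_quadratic (F : fieldType) (n : nat) (M : 'M[F]_n) (r : 'rV[F]_n) (a : F) :
    is_trig_mx M -> r != 0 -> r *m M *m M + r *m M + a *: r = 0 ->
  exists t : F, t ^+ 2 + t + a = 0.
Proof.
move=> /is_trig_mxP trigM r0 rE.
have [j0 rj0] : exists j, r 0 j != 0.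
  apply/existsP; apply: contraNT r0 => /existsPn r0; apply/eqP/rowP => j.
  by rewrite mxE; apply/eqP; move: (r0 j); rewrite negbK.
case: (arg_maxnP (P := fun j => r 0 j != 0) (fun j : 'I_n => val j) rj0) => j rj jmax.
have supp0 (k : 'I_n) : (j < k)%N -> r 0 k = 0.
  by move=> jk; apply/eqP; apply: contraTT jk => /jmax /=; rewrite -leqNgt.
have mul_top (w : 'rV_n) : (forall k : 'I_n, (j < k)%N -> w 0 k = 0) ->
    (w *m M) 0 j = w 0 j * M j j.
  move=> supp; rewrite mxE (bigD1 j) //= big1 ?addr0 // => i ij.
  have [ji | ij'] := ltnP j i; first by rewrite supp // mul0r.
  by rewrite trigM ?mulr0 // ltn_neqAle ij' andbT.
have supp1 (k : 'I_n) : (j < k)%N -> (r *m M) 0 k = 0.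
  move=> jk; rewrite mxE big1 // => i _.
  have [ji | ij] := ltnP j i; first by rewrite supp0 // mul0r.
  by rewrite trigM ?mulr0 // (leq_ltn_trans ij).
exists (M j j); apply: (mulfI rj).
have := congr1 (fun w : 'rV_n => w 0 j) rE.
have rowD (w1 w2 : 'rV[F]_n) : (w1 + w2) 0 j = w1 0 j + w2 0 j by rewrite mxE.
have rowZ (c : F) (w : 'rV[F]_n) : (c *: w) 0 j = c * w 0 j by rewrite mxE.
have row0 : (0 : 'rV[F]_n) 0 j = 0 by rewrite mxE.
rewrite !rowD rowZ row0.
by rewrite !mul_top // mulr0 => <-; ring.
Qed.

Lemma triangularizable_quadratic (F : fieldType) (V : vectType F) (u : 'End(V))
    (a : F) (v : V) :
    triangularizable u -> v != 0 -> u (u v) + u v + a *: v = 0 ->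
  exists t : F, t ^+ 2 + t + a = 0.
Proof.
case=> b [b_basis trigM] v0 uv0.
apply: (trig_mx_quadratic (r := rVof b v) trigM).
  by rewrite rVof_eq0.
have := congr1 (rVof b) uv0.
by rewrite !linearD linearZ linear0 /= !(rVof_app b b_basis).
Qed.

(** The two equations give the matrix that describes [u] on [x1], [x2], [x3] the characteristic
    polynomial t^3 - (1 - a) t - a = (t - 1)(t^2 + t + a). The conclusion is the vanishing of the
    determinant of the matrix ([fi xj]), whose diagonal is zero. *)
Lemma triple_charpoly (F : fieldType) (V : vectType F) (S : {vspace 'End(V)})
    (x1 x2 x3 : V) (f1 f2 f3 : 'Hom(V, F^o)) (a c1 c2 c3 : F) :
    weakly_triangularizable S -> (forall t : F, t ^+ 2 + t + a != 0) ->
    tensor f1 x1 \in S -> tensor f2 x2 \in S -> tensor f3 x3 \in S ->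
    f1 x1 = 0 -> f2 x2 = 0 -> f3 x3 = 0 ->
    c1 * c2 * ((f1 x2 : F) * f2 x1) + c1 * c3 * ((f1 x3 : F) * f3 x1) +
      c2 * c3 * ((f2 x3 : F) * f3 x2) = 1 - a ->
    c1 * c2 * c3 * ((f1 x2 : F) * f2 x3 * f3 x1 + (f1 x3 : F) * f3 x2 * f2 x1) = a ->
  (f1 x2 : F) * f2 x3 * f3 x1 + (f1 x3 : F) * f3 x2 * f2 x1 = 0.
Proof.
move=> wtS a_irr S1 S2 S3 h1 h2 h3 sE dE.
pose u := c1 *: tensor f1 x1 + c2 *: tensor f2 x2 + c3 *: tensor f3 x3.
have uS : u \in S by rewrite !memvD ?memvZ.
have uE z : u z = (c1 * f1 z) *: x1 + (c2 * f2 z) *: x2 + (c3 * f3 z) *: x3.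
  by rewrite !(add_lfunE, scale_lfunE) !tensorE !scalerA.
(* The characteristic polynomial (t - 1)(t^2 + t + a) kills x1, hence its
   quadratic factor kills v. *)
pose v := u x1 - x1.
have fE (f : 'Hom(V, F^o)) z1 z2 z3 :
    f (z1 *: x1 + z2 *: x2 + z3 *: x3) = z1 * f x1 + z2 * f x2 + z3 * f x3 :> F.
  by rewrite !linearD !linearZ.
have vE : v = (-1) *: x1 + (c2 * f2 x1) *: x2 + (c3 * f3 x1) *: x3.
  by rewrite /v uE h1 mulr0 scale0r add0r scaleN1r addrC addrA.
(* If [v] is zero, then [x1], [x2], [x3] are dependent, so that determinant vanishes. *)
have [v0|v_neq0] := eqVneq v 0.
  have fv (f : 'Hom(V, F^o)) :
      -1 * f x1 + c2 * f2 x1 * f x2 + c3 * f3 x1 * f x3 = 0 :> F.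
    by rewrite -fE -vE v0 linear0.
  have := fv f1; have := fv f2; have := fv f3.
  rewrite h1 h2 h3 => e3 e2 e1.
  set E1 := (X in X = 0) in e1; set E2 := (X in X = 0) in e2.
  set E3 := (X in X = 0) in e3.
  transitivity ((f3 x2 : F) * ((f2 x3 : F) * E1 - (f1 x3 : F) * E2) -
    (f1 x2 : F) * f2 x3 * E3); first by rewrite /E1 /E2 /E3; ring.
  by rewrite e1 e2 e3; ring.
have [|t /eqP] := triangularizable_quadratic (a := a) (wtS u uS) v_neq0;
  last by rewrite (negPf (a_irr t)).
have uC z1 z2 z3 : u (z1 *: x1 + z2 *: x2 + z3 *: x3) =
   (c1 * (z2 * f1 x2 + z3 * f1 x3)) *: x1 + (c2 * (z1 * f2 x1 + z3 * f2 x3)) *: x2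
   + (c3 * (z1 * f3 x1 + z2 * f3 x2)) *: x3.
  by rewrite uE !fE h1 h2 h3 !mulr0 ?(add0r, addr0).
have comb (y1 y2 y3 z1 z2 z3 : F) : (y1 *: x1 + y2 *: x2 + y3 *: x3) +
    (z1 *: x1 + z2 *: x2 + z3 *: x3) =
    (y1 + z1) *: x1 + (y2 + z2) *: x2 + (y3 + z3) *: x3.
  by rewrite !scalerDl [LHS]addrACA (addrACA (y1 *: x1)).
rewrite vE !uC !scalerDr !scalerA !comb.
set s := (X in X = 1 - a) in sE.
set d := (X in X = a) in dE.
rewrite (_ : _ + a * -1 = d - a); last by rewrite /d; ring.
rewrite (_ : _ + a * (c2 * f2 x1) = (c2 * f2 x1) * (s - (1 - a))); last by rewrite /s; ring.
rewrite (_ : _ + a * (c3 * f3 x1) = (c3 * f3 x1) * (s - (1 - a))); last by rewrite /s; ring.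
by rewrite sE dE !subrr !mulr0 !scale0r !addr0.
Qed.

(** * Quadratic polynomials and coefficient equations in characteristic 2 *)

(** If [x] had no square root, X^2 - x would be irreducible with zero derivative, hence
    inseparable. *)
Lemma perfect_char2_sqr (F : fieldType) :
  perfect_field F -> 2%N \in [pchar F] -> forall x : F, exists y, x = y ^+ 2.
Proof.
move=> perfF charF x; apply: NNPP => nosq.
have sz : size ('X^2 - x%:P : {poly F}) = 3 by rewrite size_XnsubC.
have /perfF : irreducible_poly ('X^2 - x%:P : {poly F}).
  apply: cubic_irreducible; first by rewrite sz.
  move=> y; apply/negP => /rootP; rewrite !hornerE => /eqP.
  by rewrite subr_eq0 => /eqP xE; apply: nosq; exists y; rewrite xE.
rewrite unlock derivB derivC derivXn subr0 -scaler_nat.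
rewrite (pcharf0 charF) scale0r coprimep0 => /eqp_size.
by rewrite sz size_poly1.
Qed.

Lemma third_element_char2 (F : fieldType) :
    2%N \in [pchar F] -> (exists s : seq F, uniq s /\ (2 < size s)%N) ->
  exists2 w : F, w != 0 & w + 1 != 0.
Proof.
move=> charF [s [uniq_s size_s]]; apply: NNPP => no_w.
have : {subset s <= [:: 0; 1]}.
  move=> w _; rewrite !inE; apply/norP => -[w0 w1]; apply: no_w.
  exists w => //; apply: contra_neq w1 => w1.
  by rewrite -[LHS](addrK 1) w1 (oppr_pchar2 charF) add0r.
by move=> /(uniq_leq_size uniq_s); rewrite leqNgt size_s.
Qed.

Lemma four_distinct_elements_char2 (F : fieldType) :
    2%N \in [pchar F] -> (exists s : seq F, uniq s /\ (2 < size s)%N) ->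
  exists2 s : seq F, uniq s & size s = 4%N.
Proof.
move=> charF cardF; have [w w0 w1] := third_element_char2 charF cardF.
exists [:: 0; 1; w; w + 1] => //.
have neq1w : 1 != w by rewrite eq_sym -subr_eq0 (oppr_pchar2 charF).
have neq1w1 : 1 != w + 1 by rewrite eq_sym -subr_eq0 addrK.
have neqww1 : w != w + 1 by rewrite eq_sym -subr_eq0 addrC addKr oner_eq0.
by rewrite /= !inE !negb_or ![0 == _]eq_sym oner_eq0 w0 w1 neq1w neq1w1 neqww1.
Qed.

(** The condition [a != 1] keeps [1 - a] nonzero when coefficients are solved for in
    [triple_rule]. *)
Lemma irreducible_artin_schreier (F : fieldType) :
    perfect_field F -> 2%N \in [pchar F] -> ~ quadratically_closed F ->
    (exists s : seq F, uniq s /\ (2 < size s)%N) ->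
  exists2 a : F, a != 1 & forall t : F, t ^+ 2 + t + a != 0.
Proof.
move=> perfF charF nqc cardF.
have [b b_irr] : exists b : F, forall t : F, t ^+ 2 + t + b != 0.
  apply: NNPP => all_root; apply: nqc => p sz.
  have pE x : p.[x] = p`_0 + p`_1 * x + p`_2 * x ^+ 2.
    by rewrite horner_coef sz !big_ord_recl big_ord0 expr0 mulr1 expr1 addr0 addrA.
  have p2 : p`_2 != 0.
    by have := lead_coef_eq0 p; rewrite lead_coefE sz -size_poly_eq0 sz => ->.
  (* Without linear term a square root is a root of [p]; otherwise scaling the variable by [p1 / p2]
     reduces [p] to the form t^2 + t + b. *)
  have [p1|p1] := eqVneq p`_1 0.
    have [x xE] := perfect_char2_sqr perfF charF (- p`_0 / p`_2).
    by exists x; apply/rootP; rewrite pE p1 -xE; field.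
  apply: NNPP => no_root; apply: all_root; exists (p`_0 * p`_2 / p`_1 ^+ 2) => t.
  apply: contra_not_neq no_root => tE.
  exists (p`_1 / p`_2 * t); apply/rootP; rewrite pE.
  transitivity (p`_1 ^+ 2 / p`_2 * (t ^+ 2 + t + p`_0 * p`_2 / p`_1 ^+ 2)).
    by field; rewrite p1 p2.
  by rewrite tE mulr0.
(* In characteristic 2 adding w^2 + w to [b] only translates the roots by [w], and w^2 + w = w (w +
   1) is nonzero. *)
have [b1|] := eqVneq b 1; last by exists b.
have [w w0 w1] := third_element_char2 charF cardF.
exists (b + (w ^+ 2 + w)).
  rewrite b1 -subr_eq0 addrC addKr.
  by have -> : w ^+ 2 + w = w * (w + 1); [ring | rewrite mulf_neq0].
move=> t; suff -> : t ^+ 2 + t + (b + (w ^+ 2 + w)) = (t + w) ^+ 2 + (t + w) + b by [].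
rewrite sqrrD -[t * w *+ 2]mulr_natr (pcharf0 charF) mulr0 addr0.
by ring.
Qed.

(** Set c3 = h c1, with [h] taken from a third element of the field so that k = p + h r is nonzero.
    Then c2 = s / (c1 k), and the second equation becomes linear in c1. *)
Lemma cycle_coefs_degenerate (F : fieldType) (p r d s t : F) :
    2%N \in [pchar F] -> (exists s : seq F, uniq s /\ (2 < size s)%N) ->
    p != 0 -> r != 0 -> d != 0 -> s != 0 -> t != 0 ->
  exists c1 c2 c3 : F, c1 * c2 * p + c2 * c3 * r = s /\ c1 * c2 * c3 * d = t.
Proof.
move=> charF cardF p0 r0 d0 s0 t0.
have [w w0 w1] := third_element_char2 charF cardF.
have [h h0 k0] : exists2 h, h != 0 & p + h * r != 0.
  exists (w * p / r); first by rewrite !(mulf_eq0, invr_eq0) !negb_or w0 p0.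
  by have -> : p + w * p / r * r = (w + 1) * p; [field | rewrite mulf_neq0].
have [k kE] : exists k, k = p + h * r by exists (p + h * r).
rewrite -kE in k0; have c0 : t * k / (s * h * d) != 0.
  by rewrite !(mulf_eq0, invr_eq0) !negb_or t0 k0 s0 h0 d0.
have [c cE] : exists c, c = t * k / (s * h * d) by exists (t * k / (s * h * d)).
rewrite -cE in c0.
exists c, (s / (c * k)), (c * h); split.
  transitivity (c * s / (c * k) * k); last by field; rewrite k0 c0.
  by rewrite [X in _ = _ * X]kE; field; rewrite k0 c0.
by rewrite cE; field; rewrite ?k0 ?d0 ?s0 ?h0 ?t0.
Qed.

Lemma cycle_coefs (F : fieldType) (p q r d s t : F) :
    (forall x : F, exists y, x = y ^+ 2) ->
    2%N \in [pchar F] -> (exists s : seq F, uniq s /\ (2 < size s)%N) ->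
    p != 0 -> d != 0 -> s != 0 -> t != 0 ->
  exists c1 c2 c3 : F,
    c1 * c2 * p + c1 * c3 * q + c2 * c3 * r = s /\ c1 * c2 * c3 * d = t.
Proof.
move=> sqrtF charF cardF p0 d0 s0 t0.
(* With c1 = c g and c2 = c h the terms in c3 cancel from the first equation. A square root gives
   [c], and c3 is left free for the second equation. Such [g] and [h] exist unless exactly one of
   [q], [r] is zero. *)
have balanced (g h : F) : g != 0 -> h != 0 -> g * q + h * r = 0 ->
    exists c1 c2 c3 : F,
      c1 * c2 * p + c1 * c3 * q + c2 * c3 * r = s /\ c1 * c2 * c3 * d = t.
  move=> g0 h0 gh0; have [c cE] := sqrtF (s / (g * h * p)).
  have c0 : c != 0.
    apply: contraTneq (s0) => c0; move: cE; rewrite c0 expr0n /= => /eqP.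
    by rewrite mulf_eq0 invr_eq0 !mulf_eq0 (negPf g0) (negPf h0) (negPf p0) !orbF negbK.
  pose e := t / (c ^+ 2 * g * h * d).
  exists (c * g), (c * h), e; split; last first.
    by rewrite /e; field; rewrite ?c0 ?d0 ?g0 ?h0.
  transitivity (c ^+ 2 * (g * h * p) + c * e * (g * q + h * r)); first by ring.
  by rewrite gh0 -cE; field; rewrite ?p0 ?g0 ?h0.
have [q0|q0] := eqVneq q 0; have [r0|r0] := eqVneq r 0.
- by apply: (balanced 1 1); rewrite ?oner_eq0 // q0 r0 !mulr0 addr0.
- have [c1 [c2 [c3 [sE dE]]]] := cycle_coefs_degenerate charF cardF p0 r0 d0 s0 t0.
  by exists c1, c2, c3; rewrite q0 mulr0 addr0.
- have [c1 [c2 [c3 [sE dE]]]] := cycle_coefs_degenerate charF cardF p0 q0 d0 s0 t0.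
  by exists c2, c1, c3; rewrite r0 mulr0 addr0 -sE -dE; split; ring.
- by apply: (balanced r (- q)); rewrite ?oppr_eq0 //; ring.
Qed.

(** If the sum [d] of the two cyclic products were nonzero, [cycle_coefs] would supply the
    coefficients required by [triple_charpoly], which forces [d = 0]. In characteristic 2 this is
    the claimed equality. *)
Lemma triple_rule (F : fieldType) (V : vectType F) (S : {vspace 'End(V)})
    (x1 x2 x3 : V) (f1 f2 f3 : 'Hom(V, F^o)) :
    perfect_field F -> 2%N \in [pchar F] -> ~ quadratically_closed F ->
    (exists s : seq F, uniq s /\ (2 < size s)%N) ->
    weakly_triangularizable S ->
    tensor f1 x1 \in S -> tensor f2 x2 \in S -> tensor f3 x3 \in S ->
    f1 x1 = 0 -> f2 x2 = 0 -> f3 x3 = 0 ->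
    (f1 x2 : F) != 0 -> (f2 x1 : F) != 0 ->
  (f1 x2 : F) * f2 x3 * f3 x1 = (f1 x3 : F) * f3 x2 * f2 x1.
Proof.
move=> perfF charF nqc cardF wtS S1 S2 S3 h1 h2 h3 l12 l21.
have [a a1 a_irr] := irreducible_artin_schreier perfF charF nqc cardF.
apply/eqP; rewrite -subr_eq0 (oppr_pchar2 charF); apply/eqP.
set d := _ + _; have [//|d0] := eqVneq d 0.
have a0 : a != 0 by have := a_irr 0; rewrite expr0n /= !add0r.
have s0 : 1 - a != 0 by rewrite subr_eq0 eq_sym.
have [c1 [c2 [c3 [sE dE]]]] :=
  cycle_coefs ((f1 x3 : F) * f3 x1) ((f2 x3 : F) * f3 x2)
    (perfect_char2_sqr perfF charF) charF cardF (mulf_neq0 l12 l21) d0 s0 a0.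
exact: triple_charpoly wtS a_irr S1 S2 S3 h1 h2 h3 sE dE.
Qed.

(** * Counting linked pairs on a finite grid *)

(** Let R and M count the related and the mutually related ordered pairs, and n the points. Summing
    over pairs gives 2R + n <= n^2 + M, and R >= 3n^2/4, so M > n^2/2; the diagonal term n makes
    this strict. *)
Lemma many_mutual_neighbours (T : finType) (r : rel T) :
    (0 < #|T|)%N -> irreflexive r ->
    (forall x, 4 * #|[set y | ~~ r x y]| <= #|T|)%N ->
  exists x, (#|T| < 2 * #|[set y | r x y && r y x]|)%N.
Proof.
move=> T0 irr_r dense_r; apply/existsP; apply: contraT => /existsPn few.
have pointwise x y : (r x y + r y x + (x == y) <= 1 + (r x y && r y x))%N.
  have [->|_] := eqVneq x y; first by rewrite irr_r.
  by case: (r x y); case: (r y x).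
have : (\sum_x \sum_y (r x y + r y x + (x == y)) <=
        \sum_x \sum_y (1 + (r x y && r y x)))%N.
  by apply: leq_sum => x _; apply: leq_sum => y _; apply: pointwise.
have sumE (P : rel T) : (\sum_x \sum_y P x y = \sum_x #|[set y | P x y]|)%N.
  by apply: eq_bigr => x _; rewrite -sum1dep_card [RHS]big_mkcond; apply: eq_bigr => y;
    case: (P x y).
have -> : (\sum_x \sum_y (r x y + r y x + (x == y)) =
           2 * (\sum_x \sum_y r x y) + #|T|)%N.
  under eq_bigr do rewrite !big_split /=.
  rewrite !big_split /= [(\sum_x \sum_y r y x)%N]exchange_big /= mul2n addnn.
  congr (_ + _)%N; rewrite -sum1_card; apply: eq_bigr => x _.
  by rewrite (bigD1 x) //= eqxx big1 // => y; rewrite eq_sym => /negPf ->.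
have -> : (\sum_x \sum_y (1 + (r x y && r y x)) =
           #|T| * #|T| + \sum_x \sum_y (r x y && r y x))%N.
  under eq_bigr do rewrite big_split /= sum1_card.
  by rewrite big_split /= sum_nat_const.
rewrite !sumE.
have few_sum : (2 * (\sum_x #|[set y | r x y && r y x]|) <= #|T| * #|T|)%N.
  rewrite big_distrr /= -sum_nat_const; apply: leq_sum => x _.
  by rewrite leqNgt few.
have many_sum : (3 * (#|T| * #|T|) <= 4 * \sum_x #|[set y | r x y]|)%N.
  rewrite mulnCA big_distrr /= -sum_nat_const; apply: leq_sum => x _.
  have := dense_r x; have := cardsC [set y | r x y].
  have -> : ~: [set y | r x y] = [set y | ~~ r x y] by apply/setP => y; rewrite !inE.
  move: #|_| #|_| #|T| => a b n; lia.
move: T0 many_sum few_sum; move: (\sum_x _)%N (\sum_x _)%N #|T| => a b n; nia.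
Qed.

Section Grid.
Variables (F : fieldType) (V : vectType F) (C : finType) (c : C -> F).
Hypothesis c_inj : injective c.

Definition grid_point (f : {ffun 'I_(\dim {:V}) -> C}) : V :=
  \sum_i c (f i) *: (vbasis {:V})`_i.

(** If [psi] is nonzero at the k-th basis vector, the k-th coordinate of a zero is determined by the
    others. Overwriting it arbitrarily thus embeds [#|C|] copies of the zero set in the grid. *)
Lemma card_grid_zeros (psi : 'Hom(V, F^o)) : psi != 0 ->
  (#|C| * #|[set f | (psi (grid_point f) : F) == 0%R]| <=
     #|{ffun 'I_(\dim {:V}) -> C}|)%N.
Proof.
move=> psi0; set b := vbasis {:V}.
have [k psik] : exists k : 'I_(\dim {:V}), (psi b`_k : F) != 0.
  apply/existsP; apply: contraNT psi0 => /existsPn psib.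
  apply/eqP/lfunP => x; rewrite zero_lfunE (coord_vbasis (memvf x)) linear_sum.
  apply: big1 => i _; rewrite linearZ /=.
  by move: (psib i); rewrite negbK => /eqP ->; rewrite scaler0.
pose h (p : C * {ffun 'I_(\dim {:V}) -> C}) :=
  [ffun i => if i == k then p.1 else p.2 i].
rewrite -cardsT -cardsX -(@card_in_imset _ _ h) ?max_card // => -[a f] [a' f'].
rewrite !inE /= => /eqP zf /eqP zf' /ffunP hE.
have aE : a = a' by have := hE k; rewrite !ffunE eqxx.
have fE i : i != k -> f i = f' i.
  by move=> ik; have := hE i; rewrite !ffunE (negPf ik).
suff fk : f k = f' k.
  congr pair => //; apply/ffunP => i.
  by have [->|/fE] := eqVneq i k.
apply/c_inj/(mulIf psik); move: zf' zf.
rewrite /grid_point (bigD1 k) //= [X in _ -> psi X = 0 -> _](bigD1 k) //=.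
rewrite (eq_bigr (fun i => c (f i) *: b`_i)); last by move=> i /fE ->.
rewrite !linearD !linearZ /= => <- /addIr; exact.
Qed.

(* Each [phi x] is nonzero on at least 3/4 of a grid with four values per
   coordinate, so on average more than half of the grid is linked with x. *)
Lemma linked_vectors_avoid_two_hyperplanes (phi : V -> 'Hom(V, F^o)) :
    #|C| = 4%N -> (forall x, phi x != 0) -> (forall x, phi x x = 0) ->
  exists x, forall psi theta : 'Hom(V, F^o), psi != 0 -> theta != 0 ->
    exists y, [/\ (phi x y : F) != 0, (phi y x : F) != 0, (psi y : F) != 0 &
                  (theta y : F) != 0].
Proof.
move=> cardC phi0 phixx.
pose T := {ffun 'I_(\dim {:V}) -> C}.
pose g := grid_point.
pose r : rel T := fun f f' => (phi (g f) (g f') : F) != 0.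
have T0 : (0 < #|T|)%N by rewrite card_ffun cardC expn_gt0.
have irr_r : irreflexive r by move=> f; rewrite /r phixx eqxx.
have dense_r f : (4 * #|[set f' | ~~ r f f']| <= #|T|)%N.
  have := card_grid_zeros (phi0 (g f)); rewrite cardC; congr (4 * _ <= _)%N.
  by apply: eq_card => f'; rewrite !inE negbK.
have [f many] := many_mutual_neighbours T0 irr_r dense_r.
exists (g f) => psi theta psi0 theta0; apply: NNPP => no_y.
(* Two hyperplanes hold at most half of the grid, and more than half is linked with [g f]. *)
have sub : [set f' | r f f' && r f' f] \subset
    [set f' | (psi (g f') : F) == 0%R] :|: [set f' | (theta (g f') : F) == 0%R].
  apply/subsetP => f'; rewrite !inE => /andP[r1 r2]; apply/norP => -[z1 z2].
  by apply: no_y; exists (g f').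
have := card_grid_zeros psi0; have := card_grid_zeros theta0; rewrite cardC.
have := leq_trans (subset_leq_card sub) (leq_card_setU _ _).
by move: many; rewrite -/g -/T; move: #|_| #|_| #|_| #|_| => n1 n2 n3 n4; lia.
Qed.
End Grid.

(** * Gluing the linked forms into one symmetric bilinear form *)

Lemma form_vanishing_on_proper (F : fieldType) (V : vectType F) (U : {vspace V}) (v : V) :
  v \notin U -> exists2 psi : 'Hom(V, F^o), psi != 0 & forall u, u \in U -> psi u = 0.
Proof.
move=> vU; set b := vbasis {:V}; pose w := v - projv U v.
have w0 : w != 0.
  by apply: contraNneq vU => /eqP; rewrite subr_eq0 => /eqP ->; apply: memv_proj.
have [i wi] : exists i, coord b i w != 0.
  apply/existsP; apply: contraNT w0 => /existsPn w0.
  rewrite (coord_vbasis (memvf w)) big1 // => i _.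
  by move: (w0 i); rewrite negbK => /eqP ->; rewrite scale0r.
pose psi : 'Hom(V, F^o) := (linfun (coord b i : V -> F^o) \o (\1 - projv U))%VF.
have psiE x : psi x = coord b i (x - projv U x).
  by rewrite comp_lfunE lfunE add_lfunE opp_lfunE id_lfunE.
exists psi; last by move=> u uU; rewrite psiE projv_id // subrr linear0.
by apply: contraNneq wi => psi0; rewrite -psiE psi0 zero_lfunE.
Qed.

(** Greedy choice: a nonzero form vanishing on the span of the vectors found so far is nonzero at
    some vector of [P], which extends the free family. *)
Lemma basis_from_separating (F : fieldType) (V : vectType F) (P : V -> Prop) :
    (forall psi : 'Hom(V, F^o), psi != 0 -> exists2 y, P y & psi y != 0) ->
  exists2 X : (\dim {:V}).-tuple V, basis_of {:V} X & forall i : 'I_(\dim {:V}), P X`_i.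
Proof.
move=> sepP.
have [X [freeX sizeX PX]] : exists X : seq V,
    [/\ free X, size X = \dim {:V} & forall x, x \in X -> P x].
  suff: forall k, (k <= \dim {:V})%N -> exists X : seq V,
      [/\ free X, size X = k & forall x, x \in X -> P x] by apply.
  elim=> [|k IHk] lek; first by exists [::]; rewrite nil_free.
  have [X [freeX sizeX PX]] := IHk (ltnW lek).
  have [v vX] : exists v, v \notin <<X>>%VS.
    apply: NNPP => no_v; move: lek; rewrite ltnNge -sizeX -(eqP freeX).
    move/negP; apply; apply: dimvS; apply/subvP => v _.
    by apply/negPn/negP => vX; apply: no_v; exists v.
  have [psi psi0 psiX] := form_vanishing_on_proper vX.
  have [y Py psiy] := sepP psi psi0.
  exists (y :: X); split; rewrite /= ?sizeX //.
    by rewrite free_cons freeX andbT; apply: contraNN psiy => /psiX ->.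
  by move=> x; rewrite inE => /orP[/eqP ->|/PX].
have sizeXE : size X == \dim {:V} by apply/eqP.
exists (Tuple sizeXE) => [|i]; last by apply: PX; rewrite mem_nth ?sizeX.
rewrite basisEfree freeX subvf /= sizeX //.
Qed.

Lemma symmetric_form_of_linked (F : fieldType) (V : vectType F)
    (phi : V -> 'Hom(V, F^o)) (x1 : V) :
    (forall x, phi x != 0) ->
    (forall x y z, (phi x y : F) != 0 -> (phi y x : F) != 0 ->
       (phi x y : F) * phi y z * phi z x = (phi x z : F) * phi z y * phi y x) ->
    (forall psi theta : 'Hom(V, F^o), psi != 0 -> theta != 0 ->
       exists y, [/\ (phi x1 y : F) != 0, (phi y x1 : F) != 0, (psi y : F) != 0 &
                     (theta y : F) != 0]) ->
  exists b : V -> 'Hom(V, F^o),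
    [/\ linear b, forall x y, b x y = b y x, exists x, b x != 0 &
        forall x, b x != 0 -> exists k : F, b x = k *: phi x].
Proof.
move=> phi0 tripleP sepP.
pose N y := (phi x1 y : F) != 0 /\ (phi y x1 : F) != 0.
(* For [y] in [N] this scaling gives [n y x1 = phi x1 y], and the cyclic identity at [x1], [y], [z]
   becomes the symmetry of [n] on [N]. *)
pose k y : F := (phi x1 y : F) / phi y x1.
pose n y : 'Hom(V, F^o) := k y *: phi y.
have k0 y : N y -> k y != 0.
  by move=> [y1 y2]; rewrite /k mulf_eq0 invr_eq0 negb_or y1 y2.
have nE y z : n y z = k y * (phi y z : F) by rewrite scale_lfunE.
have nsym y z : N y -> N z -> n y z = n z y.
  move=> [y1 y2] [z1 z2]; rewrite !nE.
  have frac (p q u r s v : F) : q != 0 -> s != 0 -> p * u * s = r * v * q ->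
      p / q * u = r / s * v.
    move=> q0 s0 e; transitivity (p * u * s / (q * s)); first by field; rewrite q0 s0.
    by rewrite e; field; rewrite q0 s0.
  exact: frac (tripleP x1 y z y1 y2).
have sep1 (psi : 'Hom(V, F^o)) : psi != 0 -> exists2 y, N y & psi y != 0.
  by move=> psi0; have [y [? ? ? ?]] := sepP psi psi psi0 psi0; exists y.
have [X basisX NX] := basis_from_separating sep1.
(* Linear extension from a basis inside [N]; symmetry makes it agree with [n] on all of [N]. *)
pose b x : 'Hom(V, F^o) := \sum_i coord X i x *: n X`_i.
have lin_b : linear b.
  move=> c x y; rewrite /b scaler_sumr -big_split /=; apply: eq_bigr => i _.
  by rewrite linearP scalerDl scalerA.
have eq_on_N (psi theta : 'Hom(V, F^o)) : (forall y, N y -> psi y = theta y) -> psi = theta.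
  move=> eqN; apply/eqP; rewrite -subr_eq0; apply: contraT => /sep1 [y /eqN yE].
  by rewrite add_lfunE opp_lfunE yE subrr eqxx.
have bN x z : N z -> b x z = n z x.
  move=> Nz; rewrite sum_lfunE [x in RHS](coord_basis basisX (memvf x)) linear_sum.
  by apply: eq_bigr => i _; rewrite scale_lfunE linearZ /= (nsym _ _ (NX i) Nz).
have bnE y : N y -> b y = n y.
  by move=> Ny; apply: eq_on_N => z Nz; rewrite bN // nsym.
have n0 y : N y -> n y != 0.
  case=> y1 y2; apply: contraNneq y1 => /(congr1 (fun f : 'Hom(V, F^o) => f x1)).
  by rewrite nE zero_lfunE /k divfK // => ->.
exists b; split => //.
- move=> x y; rewrite [x in RHS](coord_basis basisX (memvf x)) linear_sum sum_lfunE.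
  by apply: eq_bigr => i _; rewrite scale_lfunE linearZ /= (bN _ _ (NX i)).
- by have [y Ny _] := sep1 _ (phi0 x1); exists y; rewrite bnE // n0.
move=> x bx0.
have [t Nt bxt] := sep1 _ bx0.
(* A nonzero [n t y] makes [t] and [y] linked, so the cyclic identity applies to [t], [y], [x]. *)
have key y : N y -> n t y != 0 -> (phi x t : F) * b x y = (b x t : F) * phi x y.
  move=> Ny nty; rewrite !bN //.
  have kty : k t * k y != 0 by rewrite mulf_neq0 ?k0.
  have nyt : n y t != 0 by rewrite nsym.
  have pty : (phi t y : F) != 0 by apply: contraNneq nty; rewrite nE => ->; rewrite mulr0.
  have pyt : (phi y t : F) != 0 by apply: contraNneq nyt; rewrite nE => ->; rewrite mulr0.
  apply: (mulfI nty); rewrite {2}(nsym _ _ Nt Ny) !nE.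
  transitivity (k t * k y * ((phi t y : F) * phi y x * phi x t)); first by ring.
  by rewrite tripleP //; ring.
have bt0 : n t != 0 by apply: n0.
have phixt : (phi x t : F) *: b x = (b x t : F) *: phi x.
  (* Two forms must be avoided at once: [y] has to detect the difference of the two sides and to
     satisfy [n t y != 0], as [key] demands. *)
  apply/eqP; rewrite -subr_eq0; apply: contraT => /sepP /(_ bt0).
  case=> y [y1 y2 + nty]; rewrite add_lfunE opp_lfunE !scale_lfunE.
  by move: (key y (conj y1 y2) nty) => e; rewrite /GRing.scale /= e subrr eqxx.
have xt0 : (phi x t : F) != 0.
  apply: contraNneq (phi0 x) => xt0; move: phixt; rewrite xt0 scale0r => /esym/eqP.
  by rewrite scaler_eq0 (negPf bxt).
exists ((b x t : F) / phi x t).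
by rewrite mulrC -scalerA -phixt scalerA mulVf // scale1r.
Qed.

(** * From an alternating form to a hurdle *)

Section SymmetricSquares.
Variables (F : fieldType) (V : vectType F) (S : {vspace 'End(V)}).
Variable b : V -> 'Hom(V, F^o).
Hypothesis lin_b : linear b.
Hypothesis b_sym : forall x y, b x y = b y x.
Hypothesis b_alt : forall x, b x x = 0.
Hypothesis bS : forall x, tensor (b x) x \in S.

Let b_add x y : b (x + y) = b x + b y.
Proof. by have := lin_b 1 x y; rewrite !scale1r. Qed.

Let b0 : b 0 = 0.
Proof. by have := b_add 0 0; rewrite addr0 -[LHS]addr0 => /addrI <-. Qed.

Let b_scale c x : b (c *: x) = c *: b x.
Proof. by have := lin_b c x 0; rewrite b0 !addr0. Qed.

Lemma polarized_mem x y : tensor (b x) y + tensor (b y) x \in S.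
Proof.
have -> : tensor (b x) y + tensor (b y) x =
    tensor (b (x + y)) (x + y) - tensor (b x) x - tensor (b y) y.
  apply/lfunP => z; rewrite !(add_lfunE, opp_lfunE) !tensorE b_add add_lfunE.
  by rewrite scalerDl !scalerDr [X in _ = X - _]addrAC
    [(b x z : F) *: x + _]addrC addrK addrA addrK.
by rewrite !rpredB.
Qed.

(* The polarized operators send the span of [e] and [x] into itself and induce
   all of gl_2 there. *)
Lemma form_rank_le2 (a : F) (e f x y : V) :
    weakly_triangularizable S -> (forall t : F, t ^+ 2 + t + a != 0) ->
    b e f = 1 -> b x e = 0 -> b x f = 0 -> b y e = 0 -> b y f = 0 ->
  b x y = 0.
Proof.
move=> wtS a_irr ef xe xf ye yf; apply/eqP; apply: contraT => xy.
pose y1 := (b x y : F)^-1 *: y.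
have xy1 : b x y1 = 1 by rewrite linearZ; apply: mulVf.
have y1e : b y1 e = 0 by rewrite b_scale scale_lfunE ye scaler0.
have y1f : b y1 f = 0 by rewrite b_scale scale_lfunE yf scaler0.
pose T u v := tensor (b u) v + tensor (b v) u.
have TE u v z : T u v z = (b u z : F) *: v + (b v z : F) *: u.
  by rewrite add_lfunE !tensorE.
(* [g] sends [e] to [x] and [x] to - a e - x, so g^2 + g + a kills [e]. *)
pose g := T x f - a *: T e y1 - T x y1.
have gS : g \in S by rewrite !rpredB ?rpredZ ?polarized_mem.
have gE z : g z = T x f z - a *: T e y1 z - T x y1 z.
  by rewrite !(add_lfunE, opp_lfunE, scale_lfunE).
have ge : g e = x.
  rewrite gE !TE xe y1e b_alt (b_sym f) ef.
  by rewrite !(scale0r, scale1r, addr0, add0r, subr0, scaler0).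
have gx : g x = - (a *: e) - x.
  rewrite gE !TE (b_sym f) xf (b_sym e) xe (b_sym y1) xy1 b_alt.
  by rewrite !(scale0r, scale1r, addr0, add0r, subr0, scaler0, sub0r).
have e0 : e != 0.
  by apply: contra_eq_neq ef => ->; rewrite b0 zero_lfunE eq_sym oner_eq0.
have [|t /eqP] := triangularizable_quadratic (a := a) (wtS _ gS) e0.
  by rewrite ge gx subrK addNr.
by rewrite (negPf (a_irr t)).
Qed.

Lemma hurdle_of_alternating_form (a : F) (e f : V) :
    2%N \in [pchar F] -> weakly_triangularizable S ->
    (forall t : F, t ^+ 2 + t + a != 0) -> b e f = 1 ->
  hurdle S.
Proof.
move=> charF wtS a_irr ef.
(* Projection onto the orthogonal of [e] and [f] along their span; [form_rank_le2] will place its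
   image in the radical of [b]. *)
pose pr x := x - (b x f : F) *: e - (b e x : F) *: f.
have bpr x z : b (pr x) z = (b x z : F) - (b x f : F) * b e z - (b e x : F) * b f z.
  rewrite /pr -!scaleN1r !b_add !b_scale !(add_lfunE, scale_lfunE).
  by rewrite /GRing.scale /=; ring.
have pre x : b (pr x) e = 0.
  by rewrite bpr b_alt (b_sym f) ef (b_sym e); ring.
have prf x : b (pr x) f = 0 by rewrite bpr b_alt ef; ring.
have bpr0 x : b (pr x) = 0.
  apply/lfunP => y; rewrite zero_lfunE.
  have yE : y = pr y + (b y f : F) *: e + (b e y : F) *: f.
    by rewrite /pr addrAC !subrK.
  rewrite yE 2!linearD 2!linearZ /= pre prf !scaler0 !addr0.
  exact: form_rank_le2 wtS a_irr ef (pre x) (prf x) (pre y) (prf y).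
have xE x : x = (b x f : F) *: e + (b e x : F) *: f + pr x.
  by rewrite /pr [RHS]addrC addrA addrAC !subrK.
have bE x : b x = (b x f : F) *: b e + (b e x : F) *: b f.
  by rewrite {1}(xE x) 2!b_add 2!b_scale bpr0 addr0.
exists <<[:: b e; b f]>>%VS; split.
  suff fr : free [:: b e; b f] by apply/eqP.
  rewrite free_cons seq1_free span_seq1; apply/andP; split.
    apply/negP => /vlineP [k ek]; have := ef.
    by rewrite ek scale_lfunE b_alt scaler0 => /eqP; rewrite eq_sym oner_eq0.
  apply/negP => /eqP f0; have := b_sym f e.
  by rewrite ef f0 zero_lfunE => /eqP; rewrite eq_sym oner_eq0.
move=> phi x; rewrite span_cons span_seq1 => /memv_addP [_ /vlineP [c ->]].
case=> _ /vlineP [d ->] ->; rewrite -!b_scale -b_add.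
(* Every form of the plane is such a [b u]. Here [pr x] is handled by polarization, and the rest of
   [x] lies in the span of [e] and [f], orthogonal to [u], so it is a multiple of [u] unless
   [u = 0]. *)
set u := c *: e + d *: f => ux.
have wS : tensor (b u) (pr x) \in S.
  have := polarized_mem u (pr x); congr (_ \in S).
  apply/lfunP => z; rewrite add_lfunE !tensorE bpr0 zero_lfunE scale0r.
  by rewrite addr0.
have [k kE] : exists k : F, tensor (b u) ((b x f : F) *: e + (b e x : F) *: f) =
    k *: tensor (b u) u.
  have cross : c * (b e x : F) = d * (b x f : F).
    apply/eqP; rewrite -subr_eq0 (oppr_pchar2 charF) (b_sym x) -ux /u.
    by rewrite b_add !b_scale add_lfunE !scale_lfunE.
  have [c0|c0] := eqVneq c 0; last first.
    exists ((b x f : F) / c); apply/lfunP => z; rewrite scale_lfunE !tensorE.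
    rewrite scalerA [_ / c * _]mulrC -scalerA; congr (_ *: _).
    rewrite /u scalerDr !scalerA divfK // mulrAC [_ * d]mulrC -cross mulrAC.
    by rewrite divff // mul1r.
  have [d0|d0] := eqVneq d 0.
    exists 0; rewrite /u c0 d0 !scale0r addr0 b0; apply/lfunP => z.
    by rewrite tensorE !zero_lfunE scale0r.
  have xf0 : (b x f : F) = 0.
    by apply: (mulfI d0); rewrite -cross c0 mul0r mulr0.
  exists ((b e x : F) / d); apply/lfunP => z; rewrite scale_lfunE !tensorE.
  rewrite scalerA [_ / d * _]mulrC -scalerA; congr (_ *: _).
  by rewrite /u c0 xf0 !scale0r !add0r scalerA divfK.
have -> : tensor (b u) x = k *: tensor (b u) u + tensor (b u) (pr x).
  rewrite -kE; apply/lfunP => z; rewrite add_lfunE !tensorE -scalerDr -xE //.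
by rewrite rpredD ?rpredZ.
Qed.

End SymmetricSquares.

Theorem theorem4p1 (F : fieldType) (V : vectType F) (S : {vspace 'End(V)})
    (perfectF : perfect_field F)
    (charF : 2%N \in [pchar F])
    (not_qclosedF : ~ quadratically_closed F)
    (cardF : exists s : seq F, uniq s /\ (2 < size s)%N)
    (dimV : (3 <= \dim {:V})%N)
    (wtS : weakly_triangularizable S) :
  hurdle S \/ exists x : V, adapted S x.
Proof.
have [[x Sx]|no_adapted] := classic (exists x, adapted S x); first by right; exists x.
left; have [a _ a_irr] := irreducible_artin_schreier perfectF charF not_qclosedF cardF.
have ex_phi0 x : x != 0 -> exists phi : 'Hom(V, F^o),
    [&& phi != 0, phi x == 0 & tensor phi x \in S].
  move=> x0; apply: NNPP => no_phi; apply: no_adapted; exists x; split=> // phi phix phiS.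
  by apply/eqP/negPn/negP => phi0; apply: no_phi; exists phi; rewrite phi0 phix eqxx.
have ex_phi x : exists phi : 'Hom(V, F^o),
    [&& phi != 0, phi x == 0 & tensor phi x \in S].
  (* The zero vector borrows the form of a nonzero vector, which makes [phi] a total function. *)
  have [->|/ex_phi0 //] := eqVneq x 0.
  have [y y0] : exists y : V, y != 0.
    exists (vpick {:V}); rewrite vpick0 -dimv_eq0.
    by case: (\dim _) dimV.
  have [phi /andP[phi0 _]] := ex_phi0 y y0.
  exists phi; rewrite phi0 linear0 eqxx /=.
  have -> : tensor phi 0 = 0 by apply/lfunP => z; rewrite tensorE zero_lfunE scaler0.
  exact: mem0v.
pose phi x := xchoose (ex_phi x).
have phiP x : [/\ phi x != 0, phi x x = 0 & tensor (phi x) x \in S].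
  by have /and3P[? /eqP ? ?] := xchooseP (ex_phi x).
have phi0 x : phi x != 0 by case: (phiP x).
have phixx x : phi x x = 0 by case: (phiP x).
have phiS x : tensor (phi x) x \in S by case: (phiP x).
have [s uniq_s size_s] := four_distinct_elements_char2 charF cardF.
have cardC : #|{: seq_sub s}| = 4%N by rewrite card_seq_sub.
have [x1 sepP] := linked_vectors_avoid_two_hyperplanes val_inj cardC phi0 phixx.
have tripleP x y z : (phi x y : F) != 0 -> (phi y x : F) != 0 ->
    (phi x y : F) * phi y z * phi z x = (phi x z : F) * phi z y * phi y x.
  exact: (triple_rule perfectF charF not_qclosedF cardF wtS).
have [b [lin_b b_sym [e be0] b_phi]] := symmetric_form_of_linked phi0 tripleP sepP.
have b_alt x : b x x = 0.
  have [->|/b_phi [k ->]] := eqVneq (b x) 0; first by rewrite zero_lfunE.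
  by rewrite scale_lfunE phixx scaler0.
have bS x : tensor (b x) x \in S.
  have [->|/b_phi [k ->]] := eqVneq (b x) 0.
    have -> : tensor 0 x = 0 by apply/lfunP => z; rewrite tensorE !zero_lfunE scale0r.
    exact: mem0v.
  have -> : tensor (k *: phi x) x = k *: tensor (phi x) x.
    by apply/lfunP => z; rewrite scale_lfunE !tensorE scale_lfunE scalerA.
  by rewrite rpredZ.
have [f bef] : exists f, (b e f : F) != 0.
  apply: NNPP => no_f; move/eqP: be0; apply; apply/lfunP => f; rewrite zero_lfunE.
  by apply/eqP/negPn/negP => bef; apply: no_f; exists f.
apply: (hurdle_of_alternating_form (e := e) (f := (b e f : F)^-1 *: f)
  lin_b b_sym b_alt bS charF wtS a_irr).
by rewrite linearZ; apply: mulVf.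
Qed.
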